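(* The classes of the polynomials $\{ Q_{T}^{\mu;m} \}_{\mu\in P(n-2;k-1)}$ form a basis (over $\mathbb{Q}$) of $\gamma_T({\bf QI_m}^* )$.
   Context: Let $m\ge 0$ and $n\ge k\ge 2$ be integers, and $K_n=\mathbb{Q}[x_1,\dots,x_n]$ with $S_n$ acting by permuting variables, $\sigma P(x_1,\dots,x_n)=P(x_{\sigma(1)},\dots,x_{\sigma(n)})$. The space of $m$-quasiinvariants ${\bf QI_m}$ consists of all $P\in K_n$ such that $(1-(i,j))P$ is divisible by $(x_i-x_j)^{2m+1}$ for every transposition $(i,j)\in S_n$. Let ${\bf QI_m}^*={\bf QI_m}/\langle e_1,\dots,e_n\rangle$, where $e_i$ is the $i$-th elementary symmetric polynomial (i.e. the quotient by the ideal generated by symmetric polynomials of positive degree). Let $T=T(1,2,\dots,k)$ be the standard tableau of hook shape $\lambda=(n-k+1,1^{k-1})$ whose first column has entries $1,2,\dots,k$ (top to bottom) and whose first row has entries $1,k+1,k+2,\dots,n$ (left to right). Let $\gamma_T=\frac{f_\lambda\, C(T)R(T)}{n!}\in\mathbb{Q}S_n$, where $f_\lambda$ is the number of standard tableaux of shape $\lambda$, $C(T)=\sum_{\sigma}\mathrm{sgn}(\sigma)\sigma$ over permutations preserving each column of $T$, and $R(T)=\sum_\sigma\sigma$ over permutations preserving each row of $T$; $\gamma_T$ acts on ${\bf QI_m}$ and hence on ${\bf QI_m}^*$. For a nonnegative integer $p$ and $1\le i<j\le k$ put $R_{T;i,j}^{p;m}=\int_{x_i}^{x_j}t^p\prod_{l=1}^n(t-x_l)^m\,dt$.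 Let $P(n-2;k-1)$ be the set of integer sequences $\mu=(\mu_1,\dots,\mu_{k-1})$ with $n-2\ge\mu_1>\mu_2>\dots>\mu_{k-1}\ge 0$, and for such $\mu$ define $Q_T^{\mu;m}=\det\bigl(R_{T;i,i+1}^{\mu_j;m}\bigr)_{1\le i,j\le k-1}$ (row $i$ uses the integral from $x_i$ to $x_{i+1}$, column $j$ uses exponent $\mu_j$). These $Q_T^{\mu;m}$ lie in $\gamma_T({\bf QI_m})$. *)

(* Defs.v *)
From mathcomp Require Export all_boot all_order all_fingroup all_algebra.
From mathcomp Require Export mpoly.
From mathcomp Require Import zify.

Set Implicit Arguments.
Unset Strict Implicit.
Unset Printing Implicit Defensive.

Import GRing.Theory.
Local Open Scope ring_scope.

(* Variables, tableau entries, rows and columns are numbered from 0, so that the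
   usual x_1, ..., x_n are 'X_0, ..., 'X_(n-1).
   [msym s P] is P(x_{s(1)}, ..., x_{s(n)}). *)

Section QuasiInvariants.
Variables (n m : nat).
Implicit Types P : {mpoly rat[n]}.

Definition quasiinvariant P : Prop :=
  forall i j : 'I_n, i != j ->
    exists q : {mpoly rat[n]},
      P - msym (tperm i j) P = q * ('X_i - 'X_j) ^+ (2 * m + 1).

(* The ideal <e_1, ..., e_n> of the ring QI_m: the cofactors range over QI_m,
   not over all polynomials. *)
Definition sym_ideal P : Prop :=
  exists q : 'I_n -> {mpoly rat[n]},
    (forall i, quasiinvariant (q i)) /\
    P = \sum_(i < n) mesym n rat i.+1 * q i.

End QuasiInvariants.

(* For linear subspaces I and W of V: the classes modulo I of the family
   (v j)_{j in A} form a basis of the image of W in V / I. *)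
Definition basis_modulo (F : fieldType) (V : lmodType F) (I W : V -> Prop)
    (J : finType) (A : {set J}) (v : J -> V) : Prop :=
  [/\ forall j, j \in A -> exists2 w, W w & I (v j - w),
      forall c : J -> F, I (\sum_(j in A) c j *: v j) ->
        forall j, j \in A -> c j = 0
    & forall w, W w -> exists c : J -> F, I (w - \sum_(j in A) c j *: v j)].

Section Tableaux.
Variable n : nat.

(* A filling by 0, ..., n-1 is encoded by the (row, column) position of each
   entry. *)
Definition filling := {ffun 'I_n -> 'I_n * 'I_n}.
Implicit Type t : filling.

Definition row_of t (i : 'I_n) : nat := (t i).1.
Definition col_of t (i : 'I_n) : nat := (t i).2.

(* When sh is a partition of n, injectivity forces t to fill all of sh. *)
Definition is_standard (sh : seq nat) t : bool :=
  [&& injectiveb t,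
      [forall i, (col_of t i < nth 0%N sh (row_of t i))%N],
      [forall i, forall j, (row_of t i == row_of t j) &&
                           (col_of t i < col_of t j)%N ==> (i < j)%N]
    & [forall i, forall j, (col_of t i == col_of t j) &&
                           (row_of t i < row_of t j)%N ==> (i < j)%N]].

Definition num_standard (sh : seq nat) : nat :=
  #|[set t : filling | is_standard sh t]|.

Definition row_stab t : {set 'S_n} :=
  [set s : 'S_n | [forall i, row_of t (s i) == row_of t i]].
Definition col_stab t : {set 'S_n} :=
  [set s : 'S_n | [forall i, col_of t (s i) == col_of t i]].

Definition row_sym t (P : {mpoly rat[n]}) : {mpoly rat[n]} :=
  \sum_(s in row_stab t) msym s P.
Definition col_antisym t (P : {mpoly rat[n]}) : {mpoly rat[n]} :=
  \sum_(s in col_stab t) (-1) ^+ odd_perm s *: msym s P.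

(* The action of f_sh C(t) R(t) / n!; the action being a left one, R(t) is
   applied first. *)
Definition gamma (sh : seq nat) t (P : {mpoly rat[n]}) : {mpoly rat[n]} :=
  ((num_standard sh)%:R / (n`!)%:R) *: col_antisym t (row_sym t P).

Definition hook_shape (k : nat) : seq nat := (n - k + 1)%N :: nseq (k - 1) 1%N.

(* The values passed to insubd are at most i, so its default i is never used. *)
Definition hook_tableau (k : nat) : filling :=
  [ffun i : 'I_n => if (i < k)%N then (i, insubd i 0%N)
                    else (insubd i 0%N, insubd i (i - k + 1)%N)].

Lemma row_hook_tableau k i :
  row_of (hook_tableau k) i = if (i < k)%N then i : nat else 0%N.
Proof.
by rewrite /row_of ffunE; case: ifP => //= _;
  rewrite val_insubd (leq_ltn_trans _ (ltn_ord i)).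
Qed.

Lemma col_hook_tableau k i : (0 < k)%N ->
  col_of (hook_tableau k) i = if (i < k)%N then 0%N else (i - k + 1)%N.
Proof.
move=> k0; rewrite /col_of ffunE; case: ltnP => /= ki;
  rewrite val_insubd (leq_ltn_trans _ (ltn_ord i)) //.
by rewrite addn1 ltn_subrL k0 (leq_trans k0 ki).
Qed.

Lemma hook_tableau_standard k : (0 < k <= n)%N ->
  is_standard (hook_shape k) (hook_tableau k).
Proof.
move=> /andP[k0 kn]; have rE := row_hook_tableau k.
have cE i := col_hook_tableau i k0.
apply/and4P; split.
- apply/injectiveP=> i j eij.
  have er : row_of (hook_tableau k) i = row_of (hook_tableau k) j.
    by rewrite /row_of eij.
  have ec : col_of (hook_tableau k) i = col_of (hook_tableau k) j.
    by rewrite /col_of eij.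
  apply: val_inj; move: er ec; rewrite !rE !cE /=.
  by case: (ltnP i k); case: (ltnP j k); lia.
- apply/forallP=> i; rewrite rE cE; have := ltn_ord i.
  case: (ltnP i k) => [ik _|ik iln]; last by rewrite /=; lia.
  case: (nat_of_ord i) ik => [|d] dk /=; first lia.
  have dk1 : (d < k - 1)%N by lia.
  by rewrite nth_nseq dk1.
- apply/forallP=> i; apply/forallP=> j; rewrite !rE !cE.
  by apply/implyP; case: (ltnP i k); case: (ltnP j k); lia.
- apply/forallP=> i; apply/forallP=> j; rewrite !rE !cE.
  by apply/implyP; case: (ltnP i k); case: (ltnP j k); lia.
Qed.

End Tableaux.

Section Integrals.
Variable n : nat.
Implicit Type q : {poly {mpoly rat[n]}}.

Definition antideriv q : {poly {mpoly rat[n]}} :=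
  \poly_(d < (size q).+1) ((d%:R : rat)^-1 *: q`_d.-1).

Lemma deriv_antideriv q : (antideriv q)^`() = q.
Proof.
apply/polyP=> d; rewrite coef_deriv coef_poly ltnS /=.
case: ltnP => [_|/(nth_default 0) ->]; last by rewrite mul0rn.
by rewrite -scaler_nat scalerA divff ?scale1r // Num.Theory.pnatr_eq0.
Qed.

Definition integral (a b : {mpoly rat[n]}) q : {mpoly rat[n]} :=
  (antideriv q).[b] - (antideriv q).[a].

(* The variable of index i when i < n, and a junk value 0 otherwise. *)
Definition var (i : nat) : {mpoly rat[n]} :=
  if insub i is Some j then 'X_(j : 'I_n) else 0.

(* Integral from x_i to x_j of t^p \prod_l (t - x_l)^m dt. *)
Definition Rint (m p i j : nat) : {mpoly rat[n]} :=
  integral (var i) (var j)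
    ('X^p * \prod_(l < n) ('X - ('X_l : {mpoly rat[n]})%:P) ^+ m).

Definition Qdet (m r N : nat) (mu : r.-tuple 'I_N.+1) : {mpoly rat[n]} :=
  \det (\matrix_(i < r, j < r) Rint m (tnth mu j) i i.+1).

End Integrals.

(* P(N; r): sequences N >= mu_1 > ... > mu_r >= 0. *)
Definition decr_seqs (N r : nat) : {set r.-tuple 'I_N.+1} :=
  [set mu : r.-tuple 'I_N.+1 | sorted (fun a b : 'I_N.+1 => (b < a)%N) mu].

(* Main.v *)
From HB Require Import structures.
From mathcomp Require Import zify ring.
Require Import Defs.

(* Write H_0 = 1 and H_(p+1)(x_j) for an antiderivative of t^p \prod_l (t - x_l)^m
   evaluated at x_j; these are quasiinvariants.  Let D = det (H_i(x_j)), i, j < n.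

   - D is nonzero: a linear relation between its rows gives a polynomial F of
     degree < n(m+1) divisible by every (t - x_j)^(m+1).
   - An alternating quasiinvariant is divisible by \prod_(i<j) (x_i - x_j)^(2m+1);
     by degree, D is a nonzero scalar multiple of this product.  So alternating
     any quasiinvariant gives h D with h symmetric.
   - Q^mu = C(T) (\prod_i H_(mu_i + 1)(x_(i+1))).  For the complement nu of mu in
     {0, ..., n-2}, alternating Q^mu' \prod_j H_(nu_j + 1)(x_(k+j)) gives a nonzero
     multiple of D if mu' = mu and 0 otherwise.  This pairing has values in the
     symmetric multiples of D, hence gives the independence of the Q^mu.
   - Conversely, C(T) R(T) P is by Cramer's rule a combination of the Q^mu with
     rational functions as coefficients; the pairing identifies these with the
     symmetric polynomials h above. *)

Set Implicit Arguments.
Unset Strict Implicit.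
Unset Printing Implicit Defensive.

Import Order.TTheory GRing.Theory Num.Theory.
Local Open Scope ring_scope.

(** * Divisibility by prime elements of a domain *)

Section PrimeElements.
Variable A : idomainType.
Implicit Types a b c p : A.

Definition divides a b : Prop := exists c, b = c * a.

Definition prime_element p : Prop :=
  [/\ p != 0, ~ divides p 1
    & forall a b, divides p (a * b) -> divides p a \/ divides p b].

Lemma divides_mull a b c : divides a b -> divides a (c * b).
Proof. by case=> d ->; exists (c * d); rewrite mulrA. Qed.

Lemma divides_exp_cancel p a b e : prime_element p ->
  ~ divides p a -> divides (p ^+ e) (a * b) -> divides (p ^+ e) b.
Proof.
case=> p0 _ pP pa; elim: e b => [|e IHe] b; first by exists b; rewrite mulr1.
case=> c E; have /pP[//|[d bE]] : divides p (a * b).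
  by exists (c * p ^+ e); rewrite E exprSr mulrA.
have [|f dE] := IHe d; last by exists f; rewrite bE dE -mulrA -exprSr.
exists c; apply: (mulIf p0); move: E; rewrite bE exprSr => E.
by rewrite -!mulrA.
Qed.

Lemma prime_divides_exp p a e : prime_element p ->
  divides p (a ^+ e) -> divides p a.
Proof.
case=> p0 p1 pP; elim: e => [|e IHe]; first by rewrite expr0.
by rewrite exprS => /pP[|/IHe].
Qed.

Lemma prime_divides_prod (I : eqType) (s : seq I) (f : I -> A) p :
  prime_element p -> divides p (\prod_(i <- s) f i) ->
  exists2 i, i \in s & divides p (f i).
Proof.
case=> p0 p1 pP; elim: s => [|i s IHs]; first by rewrite big_nil.
rewrite big_cons => /pP[pi|/IHs[j js pj]].
  by exists i; rewrite ?mem_head.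
by exists j; rewrite // inE js orbT.
Qed.

(** A prime dividing none of the other primes does not divide the product of their powers, so its
    own power passes to the cofactor. No unique factorization is invoked. *)
Lemma divides_prod_primes (I : eqType) (s : seq I) (f : I -> A) e b :
  uniq s -> {in s, forall i, prime_element (f i)} ->
  {in s &, forall i j, divides (f i) (f j) -> i = j} ->
  {in s, forall i, divides (f i ^+ e) b} ->
  divides (\prod_(i <- s) f i ^+ e) b.
Proof.
elim: s => [|i s IHs] /=; first by exists b; rewrite big_nil mulr1.
case/andP=> is_ us pf inj fb.
have sub j : j \in s -> j \in i :: s by rewrite inE orbC => ->.
have [j js|j l js ls|j js|c bE] := IHs us.
- exact: pf (sub _ js).
- exact: inj (sub _ js) (sub _ ls).
- exact: fb (sub _ js).
have pi := pf i (mem_head _ _).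
have [||d cE] := @divides_exp_cancel (f i) (\prod_(j <- s) f j ^+ e) c e pi.
- case/(prime_divides_prod pi) => j js /(prime_divides_exp pi) fij.
  by move: is_; rewrite (inj _ _ (mem_head _ _) (sub _ js) fij) js.
- by rewrite mulrC -bE; apply: fb; rewrite mem_head.
by exists d; rewrite bE cE big_cons mulrA.
Qed.


End PrimeElements.

Lemma divides_XsubC (R : idomainType) (a : R) (f : {poly R}) :
  divides ('X - a%:P) f <-> root f a.
Proof.
by split=> [[q ->]|/factor_theorem//]; rewrite rootE !hornerE subrr mulr0.
Qed.

Lemma prime_XsubC (R : idomainType) (a : R) :
  prime_element ('X - a%:P : {poly R}).
Proof.
split; first by rewrite polyXsubC_eq0.
- by rewrite divides_XsubC rootE hornerE oner_eq0.
- move=> f g; rewrite !divides_XsubC rootM.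
  by case/orP; [left|right].
Qed.

(** * Derivatives and divisibility in characteristic zero *)

Section DerivativesInCharacteristicZero.
Variable R : idomainType.
Hypothesis torsion_free : forall (a : R) d, a *+ d.+1 = 0 -> a = 0.
Implicit Types (f g h : {poly R}) (a b : R).

Lemma deriv_eq0 f : f^`() = 0 -> f = (f`_0)%:P.
Proof.
move=> f'0; apply/polyP=> -[|d]; rewrite coefC //=.
by apply: (@torsion_free _ d); rewrite -coef_deriv f'0 coef0.
Qed.

(* Rescaling t = a + s (b - a) pulls the factor (b - a)^(2m+1) out of the
   integral. *)
Lemma divides_horner_sub f g a b m :
  (forall h, exists H, H^`() = h) ->
  f^`() = g * (('X - a%:P) ^+ m * ('X - b%:P) ^+ m) ->
  divides ((b - a) ^+ (2 * m + 1)) (f.[b] - f.[a]).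
Proof.
move=> has_antideriv f'E; pose L : {poly R} := a%:P + (b - a) *: 'X.
have La : L - a%:P = (b - a) *: 'X by rewrite /L addrAC subrr add0r.
have Lb : L - b%:P = (b - a) *: ('X - 1%:P).
  by rewrite /L scalerBr -!mul_polyC polyCB mulr1; ring.
have L' : L^`() = (b - a)%:P.
  by rewrite /L derivD derivC derivZ derivX add0r alg_polyC.
have [H H'] := has_antideriv ((g \Po L) * ('X ^+ m * ('X - 1%:P) ^+ m)).
(* The derivative of [L] contributes one factor [b - a] and the two vanishing factors [m] each; the
   constant of integration cancels between the endpoints. *)
have der : (f \Po L - ((b - a) ^+ (2 * m + 1)) *: H)^`() = 0.
  rewrite derivB deriv_comp derivZ H' f'E L'.
  rewrite !comp_polyM !rmorphXn /= !comp_polyB !comp_polyX !comp_polyC La Lb.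
  rewrite !exprZn -!mul_polyC addn1 exprS mul2n -addnn exprD !polyCM.
  by ring.
have E x : f.[L.[x]] = (b - a) ^+ (2 * m + 1) * H.[x]
    + (f \Po L - ((b - a) ^+ (2 * m + 1)) *: H)`_0.
  rewrite -horner_comp -hornerZ -[X in _ + X](hornerC _ x) -deriv_eq0 //.
  by rewrite hornerD hornerN addrC subrK.
exists (H.[1] - H.[0]).
have L0 : L.[0] = a by rewrite /L hornerD hornerC hornerZ hornerX; ring.
have L1 : L.[1] = b by rewrite /L hornerD hornerC hornerZ hornerX; ring.
by rewrite -{1}L1 -{1}L0 !E; ring.
Qed.

(** If [a] had multiplicity [j + 1 <= m] in [f], dividing the derivative by the [j]-th power of
    ['X - a] and evaluating at [a] would give [(j + 1) g(a) = 0] for a cofactor [g] not vanishing at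
    [a]. *)
Lemma divides_of_deriv f a m :
  root f a -> divides (('X - a%:P) ^+ m) f^`() ->
  divides (('X - a%:P) ^+ m.+1) f.
Proof.
have [-> _ _|f0 fa [h f'E]] := eqVneq f 0; first by exists 0; rewrite mul0r.
have [j [g]] := multiplicity_XsubC f a; rewrite f0 /= => ga fE.
case: j fE => [|j] fE.
  by move: fa ga; rewrite fE expr0 mulr1 => ->.
suff mj : (m <= j)%N.
  by exists (g * ('X - a%:P) ^+ (j - m)); rewrite fE -mulrA -exprD addnS subnK.
rewrite leqNgt; apply: contraNN ga => jm.
have X0 : ('X - a%:P) ^+ j != 0 by rewrite expf_neq0 // polyXsubC_eq0.
have E : g^`() * ('X - a%:P) + g *+ j.+1 = h * ('X - a%:P) ^+ (m - j).
  apply: (mulIf X0); rewrite -mulrA -exprD subnK 1?ltnW // -f'E fE.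
  rewrite derivM deriv_exp derivXsubC mul1r /= mulrDl -mulrA -exprS.
  by rewrite mulrnAr mulrnAl.
have := congr1 (fun q : {poly R} => q.[a]) E.
rewrite !hornerE subrr expr0n subn_eq0 leqNgt jm !mulr0 add0r hornerMn.
by move/torsion_free/eqP.
Qed.

End DerivativesInCharacteristicZero.

(** * Determinant reductions and extension of injections *)

Lemma det_identity_rows (R : comNzRingType) (n k : nat) (kn : (k <= n)%N)
    (A : 'M[R]_n) :
  (forall i j : 'I_n, (k <= i)%N -> A i j = (i == j)%:R) ->
  \det A = \det (\matrix_(i < k, j < k) A (widen_ord kn i) (widen_ord kn j)).
Proof.
have [d nE] : exists d, n = (k + d)%N by exists (n - k)%N; rewrite subnKC.
subst n => idA; rewrite -{1}[A]submxK.
have -> : dlsubmx A = 0.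
  by apply/matrixP=> i j; rewrite !mxE idA ?leq_addr // eq_rlshift.
have -> : drsubmx A = 1%:M.
  by apply/matrixP=> i j; rewrite !mxE idA ?leq_addr // eq_rshift.
rewrite det_ublock det1 mulr1; congr (\det _); apply/matrixP=> i j.
by rewrite !mxE; congr (A _ _); apply: val_inj.
Qed.

(** Multiplying by the unitriangular [V] subtracts from each column its predecessor, so the row of
    ones becomes [(1, 0, ..., 0)]. This turns values of primitives at points into integrals between
    consecutive points. *)
Lemma det_ones_row (R : comNzRingType) (r : nat) (A : 'M[R]_r.+1) :
  (forall j, A ord0 j = 1) ->
  \det A = \det (\matrix_(i < r, j < r)
    (A (lift ord0 i) (lift ord0 j) -
     A (lift ord0 i) (widen_ord (leqnSn r) j))).
Proof.
move=> A1.
pose V : 'M[R]_r.+1 := \matrix_(i, j) ((i == j)%:R - (i.+1 == j :> nat)%:R).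
have detV : \det V = 1.
  rewrite -det_tr det_trig.
    by apply: big1 => i _; rewrite !mxE eqxx gtn_eqF // subr0.
  apply/is_trig_mxP=> i j ij; rewrite !mxE.
  by rewrite -val_eqE /= !gtn_eqF ?subr0 // (ltn_trans ij).
have BE0 i : (A *m V) i ord0 = A i ord0.
  rewrite mxE (bigD1 ord0) //= !mxE eqxx subr0 mulr1 big1 ?addr0 // => l l0.
  by rewrite !mxE (negPf l0) subr0 mulr0.
have BE i j : (A *m V) i (lift ord0 j)
    = A i (lift ord0 j) - A i (widen_ord (leqnSn r) j).
  have sum_delta a : \sum_l A i l * (l == a)%:R = A i a.
    rewrite (bigD1 a) //= eqxx mulr1 big1 ?addr0 // => l /negPf->.
    by rewrite mulr0.
  rewrite mxE -!sum_delta -sumrB; apply: eq_bigr => l _; rewrite -mulrBr mxE.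
  have -> // : (l.+1 == lift ord0 j :> nat) = (l == widen_ord (leqnSn r) j).
  by rewrite -val_eqE /= /bump /= add1n eqSS.
rewrite -[LHS]mulr1 -detV -det_mulmx (expand_det_row _ ord0) (bigD1 ord0) //=.
rewrite BE0 A1 mul1r big1 ?addr0 => [|j j0].
  rewrite /cofactor add0n expr0 mul1r; congr (\det _); apply/matrixP=> i j.
  by rewrite [RHS]mxE -BE !mxE.
case: (unliftP ord0 j) j0 => [j' ->|->]; last by rewrite eqxx.
by rewrite BE !A1 subrr mul0r.
Qed.

(** The complements of [A] and of its image have the same size; matching their enumerations extends
    [f]. *)
Lemma perm_extend (T : finType) (A : {set T}) (f : T -> T) :
  {in A &, injective f} -> exists p : {perm T}, {in A, p =1 f}.
Proof.
move=> finj; pose B := ~: (f @: A).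
have cAB : size (enum B) = size (enum (~: A)).
  rewrite -!cardE; apply: (@addnI #|A|).
  by rewrite cardsC -(card_in_imset finj) cardsC.
pose g x := if x \in A then f x else nth x (enum B) (index x (enum (~: A))).
have gB x : x \notin A -> g x \in B.
  move=> xA; rewrite /g (negPf xA) -mem_enum mem_nth // cAB index_mem.
  by rewrite mem_enum inE.
have gA x : x \in A -> g x \notin B.
  by move=> xA; rewrite inE negbK /g xA imset_f.
have ginj : injective g.
  move=> x y; case: (boolP (x \in A)) => xA; case: (boolP (y \in A)) => yA E.
  - by move: E; rewrite /g xA yA => /finj; apply.
  - by have := gA _ xA; rewrite E gB.
  - by have := gA _ yA; rewrite -E gB.
  - have ix : (index x (enum (~: A)) < size (enum B))%N.
      by rewrite cAB index_mem mem_enum inE.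
    have iy : (index y (enum (~: A)) < size (enum B))%N.
      by rewrite cAB index_mem mem_enum inE.
    move: E; rewrite /g (negPf xA) (negPf yA) (set_nth_default y x ix).
    move/eqP; rewrite nth_uniq ?enum_uniq // => /eqP E.
    have := nth_index y; move=> nI; rewrite -(nI x (enum (~: A))).
      by rewrite E nI // mem_enum inE.
    by rewrite mem_enum inE.
by exists (perm ginj) => x xA; rewrite permE /g xA.
Qed.

(** * Label sequences on the first column *)

Section HookRows.
Variables (N r : nat).
Hypothesis rN : (r <= N.+1)%N.
Local Notation n := N.+2.
Local Notation k := r.+1.
Implicit Types (mu : r.-tuple 'I_N.+1) (q : 'I_n -> 'I_n).

(* Label 0 stands for the constant function 1 and label p + 1 for the exponent p;
   the entries of mu occupy positions 1, ..., k - 1. *)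
Definition hook_row mu (i : 'I_n) : 'I_n :=
  if (0 < i < k)%N then lift ord0 (nth ord0 mu i.-1) else ord0.

Definition col_set : {set 'I_n} := [set i : 'I_n | (i < k)%N].

Lemma card_col_set : #|col_set| = k.
Proof.
have -> : col_set = [set widen_ord (rN : (k <= n)%N) i | i in 'I_k].
  apply/setP=> i; rewrite inE; apply/idP/imsetP => [ik|[j _ ->]];
    last exact: ltn_ord j.
  by exists (Ordinal ik) => //; apply: val_inj.
rewrite card_imset ?card_ord // => i j /(congr1 val) /= ij; exact: val_inj.
Qed.

Lemma hook_row_image mu :
  hook_row mu @: col_set = ord0 |: [set lift ord0 x | x in mu].
Proof.
apply/setP=> x; rewrite !inE; apply/imsetP/orP => [[i]|].
  rewrite inE /hook_row => ik ->; case: (posnP i) => [->|i0]; first by left.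
  by right; rewrite ik imset_f // mem_nth // size_tuple; lia.
case=> [/eqP->|/imsetP[y /(nthP ord0)[j jr <-] ->]].
  by exists ord0; rewrite ?inE.
rewrite size_tuple in jr.
exists (inord j.+1); first by rewrite inE inordK; lia.
by rewrite /hook_row inordK ?ltnS ?jr; last lia.
Qed.

Lemma decr_seqs_uniq mu : mu \in decr_seqs N r -> uniq mu.
Proof.
rewrite inE => /(@sorted_uniq _ _ _ _); apply.
  by move=> a b c ab bc; apply: ltn_trans bc ab.
by move=> a; rewrite /= ltnn.
Qed.

Lemma mem_lift_image mu x :
  (lift ord0 x \in hook_row mu @: col_set) = (x \in mu).
Proof.
rewrite hook_row_image !inE /= mem_imset //; exact: lift_inj.
Qed.

Lemma hook_row_inj mu : mu \in decr_seqs N r ->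
  {in col_set &, injective (hook_row mu)}.
Proof.
move=> /decr_seqs_uniq umu; apply/imset_injP.
rewrite card_col_set hook_row_image cardsU1 card_imset; last exact: lift_inj.
have /card_uniqP -> := umu; rewrite size_tuple.
by case: imsetP => // -[x _ /eqP]; rewrite eq_sym lift_eqF.
Qed.

Lemma hook_row_determines mu1 mu2 :
  mu1 \in decr_seqs N r -> mu2 \in decr_seqs N r ->
  hook_row mu1 @: col_set = hook_row mu2 @: col_set -> mu1 = mu2.
Proof.
rewrite !inE => s1 s2 E; apply: val_inj.
apply: (irr_sorted_eq (leT := fun a b : 'I_N.+1 => (b < a)%N)) => //.
- by move=> a b c ab bc; apply: ltn_trans bc ab.
- by move=> a; rewrite /= ltnn.
- by move=> x; rewrite -!(mem_lift_image _ x) E.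
Qed.

(** The nonzero labels of [q] on the column, in decreasing order, form [mu]; injectivity and the
    single label 0 leave exactly [r] of them. *)
Lemma hook_row_sort q : q ord0 = ord0 -> {in col_set &, injective q} ->
  exists2 mu, mu \in decr_seqs N r & q @: col_set = hook_row mu @: col_set.
Proof.
move=> q0 qinj; pose s := [seq x <- enum 'I_N.+1 | lift ord0 x \in q @: col_set].
have qs : q @: col_set = ord0 |: [set lift ord0 x | x in s].
  apply/setP=> x; rewrite !inE; case: (unliftP ord0 x) => [y ->|->] /=.
    rewrite mem_imset; last exact: lift_inj.
    by rewrite mem_filter mem_enum andbT.
  by rewrite -q0 imset_f // inE.
have us : uniq s by rewrite filter_uniq ?enum_uniq.
have ss : size (rev s) == r.
  have := card_in_imset qinj; rewrite card_col_set qs cardsU1 card_imset;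
    last exact: lift_inj.
  have /card_uniqP -> := us; rewrite size_rev.
  case: imsetP => [[x _ /eqP]|_ /=]; first by rewrite eq_sym lift_eqF.
  by rewrite add1n => -[->].
exists (Tuple ss).
  rewrite inE /= rev_sorted; apply: sorted_filter.
    by move=> a b c; apply: ltn_trans.
  by have := iota_ltn_sorted 0 N.+1; rewrite -val_enum_ord sorted_map.
rewrite hook_row_image qs; congr (_ |: _); apply/setP=> x.
by apply/imsetP/imsetP => -[y ys ->]; exists y => //; move: ys; rewrite mem_rev.
Qed.

End HookRows.

(* A vanishing combination of the rows gives a polynomial F constant on the
   nodes with F' divisible by all (t - x_l)^m, so that F has more roots than its
   degree allows. *)
Lemma det_integrals_neq0 (R : idomainType) (n m : nat) (x : 'I_n.+1 -> R)
    (G : 'I_n.+1 -> {poly R}) :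
  (forall (a : R) d, a *+ d.+1 = 0 -> a = 0) -> injective x ->
  G ord0 = 1 ->
  (forall p : 'I_n,
     (G (lift ord0 p))^`() = 'X^p * \prod_(l < n.+1) ('X - (x l)%:P) ^+ m) ->
  (forall i, size (G i) <= n.+1 * m.+1)%N ->
  \det (\matrix_(i, j) (G i).[x j]) != 0.
Proof.
move=> tf xinj G0 G' sG; apply/negP=> /det0P[v v0 vM].
pose w : {poly R} := \prod_(l < n.+1) ('X - (x l)%:P) ^+ m.
pose F := \sum_i v 0 i *: G i.
have FE : F = (v 0 ord0)%:P + \sum_(p < n) v 0 (lift ord0 p) *: G (lift ord0 p).
  by rewrite /F big_ord_recl G0 alg_polyC.
have F' : F^`() = (\sum_(p < n) v 0 (lift ord0 p) *: 'X^p) * w.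
  rewrite FE derivD derivC add0r raddf_sum /= mulr_suml.
  by apply: eq_bigr => p _; rewrite derivZ G' scalerAl.
have Fx j : root F (x j).
  rewrite rootE /F horner_sum; apply/eqP.
  have := congr1 (fun M : 'rV_n.+1 => M 0 j) vM; rewrite !mxE => vj.
  by rewrite -[RHS]vj; apply: eq_bigr => i _; rewrite hornerZ mxE.
have wm j : divides (('X - (x j)%:P) ^+ m) F^`().
  rewrite F'; apply: divides_mull; rewrite /w (bigD1 j) //= mulrC.
  by eexists.
have sF : (size F <= n.+1 * m.+1)%N.
  apply: leq_trans (size_sum _ _ _) _; apply/bigmax_leqP=> i _.
  exact: leq_trans (size_scale_leq _ _) (sG i).
have F0 : F = 0.
  have [||j l _ _|j _|c] := @divides_prod_primes _ _ (index_enum 'I_n.+1)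
     (fun j => 'X - (x j)%:P) m.+1 F.
  - exact: index_enum_uniq.
  - by move=> j _; apply: prime_XsubC.
  - rewrite divides_XsubC rootE hornerD hornerN hornerX hornerC subr_eq0.
    by move/eqP/xinj.
  - exact: divides_of_deriv.
  have [->|c0] := eqVneq c 0; first by rewrite mul0r.
  (* The monic product has degree [n.+1 * m.+1], already more than [F] may have, so a nonzero
     cofactor is impossible. *)
  move=> cE; move: sF; rewrite cE size_Mmonic //; last first.
    by apply: monic_prod => i _; rewrite monic_exp // monicXsubC.
  rewrite (size_prod _ (P := predT)) => [|i _]; last first.
    by rewrite expf_neq0 // polyXsubC_eq0.
  under eq_bigr do rewrite size_exp_XsubC.
  rewrite sum_nat_const card_ord.
  by rewrite -size_poly_gt0 in c0; lia.
(* The vanishing of the derivative of [F] kills the coefficients of the nonconstant rows, and [FE]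
   then kills that of the constant row. *)
have w0 : w != 0.
  by apply/prodf_neq0 => i _; rewrite expf_neq0 // polyXsubC_eq0.
have u0 : \sum_(p < n) v 0 (lift ord0 p) *: 'X^p = 0 :> {poly R}.
  by apply/eqP; rewrite -(mulIr_eq0 _ (mulIf w0)) -F' F0 deriv0.
have vp (p : 'I_n) : v 0 (lift ord0 p) = 0.
  have := congr1 (fun f : {poly R} => f`_p) u0; rewrite coef0 coef_sum.
  rewrite (bigD1 p) //= coefZ coefXn eqxx mulr1 big1 ?addr0 // => l lp.
  by rewrite coefZ coefXn eq_sym (negPf lp : (l == p :> nat) = false) mulr0.
case/eqP: v0; apply/rowP=> i; rewrite mxE.
case: (unliftP ord0 i) => [p ->|->]; first exact: vp.
move: FE; rewrite F0 big1 => [|p _]; last by rewrite vp scale0r.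
by rewrite addr0 => /esym/eqP; rewrite polyC_eq0 => /eqP.
Qed.

(** * Congruence between an element and its image under an endomorphism *)

Section FixedModulo.
Variables (A : idomainType) (phi : {rmorphism A -> A}) (d : A).
Implicit Types a b : A.

(** Being closed under sums and products, the condition need only be checked on generators. With
    [phi] a transposition and [d] the power [2 * m + 1] of ['X_i - 'X_j] it is quasiinvariance. *)
Definition fixed_mod a := divides d (a - phi a).

Lemma fixed_modE a : phi a = a -> fixed_mod a.
Proof. by move=> E; exists 0; rewrite E subrr mul0r. Qed.

Lemma fixed_modD a b : fixed_mod a -> fixed_mod b -> fixed_mod (a + b).
Proof.
case=> u aE [v bE]; exists (u + v); rewrite rmorphD mulrDl -aE -bE; ring.
Qed.

Lemma fixed_modM a b : fixed_mod a -> fixed_mod b -> fixed_mod (a * b).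
Proof.
case=> u aE [v bE]; exists (u * b + phi a * v).
rewrite rmorphM mulrDl mulrAC -aE -mulrA -bE; ring.
Qed.

Lemma fixed_mod_prod (I : Type) (s : seq I) (P : pred I) (f : I -> A) :
  (forall i, P i -> fixed_mod (f i)) -> fixed_mod (\prod_(i <- s | P i) f i).
Proof.
move=> h; apply: (big_ind fixed_mod) => //; last exact: fixed_modM.
by apply: fixed_modE; rewrite rmorph1.
Qed.

End FixedModulo.

(** * The linear forms ['X_i - 'X_j] as primes *)

Section PolynomialRing.
Variable n : nat.
Local Notation K := {mpoly rat[n]}.
Implicit Types P Q : K.

Lemma mpoly_torsion_free (a : K) d : a *+ d.+1 = 0 -> a = 0.
Proof.
by move/eqP; rewrite -scaler_nat scaler_eq0 pnatr_eq0 /= => /eqP.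
Qed.

Definition merge_var i j : K -> K :=
  comp_mpoly [tuple (if l == i then 'X_j else 'X_l) | l < n].

HB.instance Definition _ i j := GRing.RMorphism.on (merge_var i j).

Lemma merge_varX i j l :
  merge_var i j 'X_l = if l == i then 'X_j else 'X_l.
Proof. by rewrite /merge_var comp_mpolyXU -tnth_nth tnth_mktuple. Qed.

Lemma fixed_mod_merge i j P : fixed_mod (merge_var i j) ('X_i - 'X_j) P.
Proof.
elim/mpolyind: P => [|c mon P _ _ IH]; first exact/fixed_modE/rmorph0.
apply: fixed_modD => //; rewrite -mul_mpolyC; apply: fixed_modM.
  by apply: fixed_modE; rewrite /= /merge_var comp_mpolyC.
rewrite (mpolyXE_id _ mon); apply: fixed_mod_prod => l _.
rewrite -[mon l]card_ord -prodr_const.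
apply: fixed_mod_prod => _ _; rewrite /fixed_mod /= merge_varX.
case: eqP => [->|_]; first by exists 1; rewrite mul1r.
by exists 0; rewrite subrr mul0r.
Qed.

(** Substituting ['X_j] for ['X_i] changes [P] only by a multiple of ['X_i - 'X_j]. Describing the
    multiples as a kernel yields [prime_subX], because the target is a domain. *)
Lemma divides_subX i j P : divides ('X_i - 'X_j) P <-> merge_var i j P = 0.
Proof.
split=> [[c ->]|P0]; last first.
  by have := fixed_mod_merge i j P; rewrite /fixed_mod /= P0 subr0.
rewrite rmorphM rmorphB /= !merge_varX eqxx.
by case: eqP => _; rewrite subrr mulr0.
Qed.

(** Evaluation at the indicator of an index outside [{k, l}] kills ['X_k - 'X_l], hence
    ['X_i - 'X_j], so [i] and [j] lie in [{k, l}]; the orderings do the rest. *)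
Lemma divides_subX_inj (i j k l : 'I_n) :
  (i < j)%N -> (k < l)%N ->
  divides ('X_k - 'X_l : K) ('X_i - 'X_j) -> (k, l) = (i, j).
Proof.
move=> ij kl [c E].
have ev (a : 'I_n) : (a != k) -> (a != l) -> (i == a)%:R = (j == a)%:R :> rat.
  move=> ak al; have := congr1 (meval (fun b => (b == a)%:R)) E.
  rewrite mevalM !mevalB !mevalXU /= ![_ == a]eq_sym (negPf ak) (negPf al).
  by rewrite subrr mulr0 => /eqP; rewrite subr_eq0 => /eqP.
have nij : i != j by rewrite -val_eqE /= ltn_eqF.
have ei : (i == k) || (i == l).
  apply: contraT; rewrite negb_or => /andP[a b].
  by have /eqP := ev i a b; rewrite eqxx [j == i]eq_sym (negPf nij) oner_eq0.
have ej : (j == k) || (j == l).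
  apply: contraT; rewrite negb_or => /andP[a b].
  by have /esym/eqP := ev j a b; rewrite eqxx (negPf nij) oner_eq0.
case/orP: ei ij nij => /eqP->; case/orP: ej => /eqP->; rewrite ?eqxx //.
by rewrite ltnNge (ltnW kl).
Qed.

Lemma prime_subX i j : i != j -> prime_element ('X_i - 'X_j : K).
Proof.
move=> ij; split.
- apply/eqP=> /(congr1 (meval (fun l => (l == i)%:R))) /eqP.
  by rewrite meval0 mevalB !mevalXU /= eqxx [j == i]eq_sym (negPf ij) subr0 oner_eq0.
- by rewrite divides_subX rmorph1 => /eqP; rewrite oner_eq0.
- move=> P Q; rewrite !divides_subX rmorphM => /eqP; rewrite mulf_eq0.
  by case/orP=> /eqP; [left|right].
Qed.

Lemma msize_subX i j : i != j -> (1 < msize ('X_i - 'X_j : K)%R)%N.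
Proof.
move=> ij; rewrite ltnNge; apply/negP=> /msize1_polyC E.
have ev v : v i - v j = ('X_i - 'X_j : K)@_0%MM.
  by have := congr1 (meval v) E; rewrite mevalB !mevalXU mevalC.
have := ev (fun l => (l == i)%:R); rewrite -(ev (fun=> 0)) /=.
by rewrite eqxx [j == i]eq_sym (negPf ij) subrr subr0 => /eqP; rewrite oner_eq0.
Qed.

(** * Total degree bounds *)

Lemma msizeM_leq P Q : (msize (P * Q) <= (msize P + msize Q).-1)%N.
Proof.
have [->|P0] := eqVneq P 0; first by rewrite mul0r msize0.
have [->|Q0] := eqVneq Q 0; first by rewrite mulr0 msize0.
by rewrite msizeM.
Qed.

Lemma msize_prod_leq (I : Type) (s : seq I) (f : I -> K) (d : I -> nat) :
  (forall i, msize (f i) <= (d i).+1)%N ->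
  (msize (\prod_(i <- s) f i) <= (\sum_(i <- s) d i).+1)%N.
Proof.
move=> fd; elim: s => [|i s IHs]; first by rewrite !big_nil msize1.
rewrite !big_cons; apply: leq_trans (msizeM_leq _ _) _.
by have := fd i; lia.
Qed.

Lemma msize_prod_gt (I : Type) (s : seq I) (f : I -> K) (d : I -> nat) :
  (forall i, d i < msize (f i))%N ->
  (\sum_(i <- s) d i < msize (\prod_(i <- s) f i)%R)%N.
Proof.
move=> fd; elim: s => [|i s IHs]; first by rewrite !big_nil msize1.
rewrite !big_cons msizeM.
- move: (fd i) IHs; move: (msize _) (msize _) => a b.
  by move: (\sum_(j <- s) d j)%N => c; lia.
- by rewrite -msize_poly_eq0 -lt0n; apply: leq_ltn_trans (fd i).
- by rewrite -msize_poly_eq0 -lt0n; apply: leq_ltn_trans IHs.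
Qed.

Lemma msize_sum_leq (I : Type) (s : seq I) (P : pred I) (f : I -> K) d :
  (forall i, P i -> msize (f i) <= d)%N ->
  (msize (\sum_(i <- s | P i) f i)%R <= d)%N.
Proof.
move=> fd; apply: leq_trans (msize_sum _ _ _) _.
by apply: (big_ind (fun x => x <= d)%N) => // a b; rewrite geq_max => -> ->.
Qed.

(* The total degree of f in t and the x's is at most d; the truncated
   subtraction makes the coefficients of index > d vanish. *)
Definition total_degree_le d (f : {poly K}) : Prop :=
  forall i, (msize f`_i <= d.+1 - i)%N.

Lemma total_degreeM d e f g : total_degree_le d f -> total_degree_le e g ->
  total_degree_le (d + e) (f * g).
Proof.
move=> fd ge i; rewrite coefM; apply: msize_sum_leq => j _.
have [fj0|fj0] := eqVneq f`_j 0; first by rewrite fj0 mul0r msize0.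
have [gj0|gj0] := eqVneq g`_(i - j) 0; first by rewrite gj0 mulr0 msize0.
rewrite msizeM //; move: (fd j) (ge (i - j)%N) (ltn_ord j) fj0 gj0.
by rewrite -!msize_poly_eq0; move: (msize f`_j) (msize g`_(i - j)) => a b; lia.
Qed.

Lemma total_degree1 : total_degree_le 0 1.
Proof. by move=> [|i]; rewrite coef1 ?msize1 ?msize0. Qed.

Lemma total_degree_prod (I : Type) (s : seq I) (f : I -> {poly K}) (d : I -> nat) :
  (forall i, total_degree_le (d i) (f i)) ->
  total_degree_le (\sum_(i <- s) d i) (\prod_(i <- s) f i).
Proof.
move=> fd; elim: s => [|i s IHs]; first by rewrite !big_nil; apply: total_degree1.
by rewrite !big_cons; apply: total_degreeM.
Qed.

Lemma total_degree_exp d f e :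
  total_degree_le d f -> total_degree_le (e * d) (f ^+ e).
Proof.
move=> fd; elim: e => [|e IHe]; first exact: total_degree1.
by rewrite exprS mulSn; apply: total_degreeM.
Qed.

Lemma msizeXU j : msize ('X_j : K) = 2%N.
Proof. by rewrite msizeX mdeg1. Qed.

Lemma total_degree_XsubX j : total_degree_le 1 ('X - ('X_j)%:P).
Proof.
move=> [|[|i]]; rewrite coefB coefX coefC /= ?subr0 ?sub0r ?mmeasureN ?msizeXU //.
- by rewrite msize1.
- by rewrite msize0.
Qed.

Lemma total_degreeX : total_degree_le 1 'X.
Proof. by move=> [|[|i]]; rewrite coefX /= ?msize0 ?msize1. Qed.

Lemma total_degree_antideriv d f :
  total_degree_le d f -> total_degree_le d.+1 (antideriv f).
Proof.
move=> fd [|i]; rewrite coef_poly.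
  (* The coefficient of index 0 carries the scalar [0^-1 = 0], so there is no constant term. *)
  by rewrite ltn0Sn invr0 scale0r msize0.
case: ltnP => _; last by rewrite msize0.
by apply: leq_trans (msizeZ_le _ _) _; rewrite subSS; apply: fd.
Qed.

Lemma msize_horner d f j : total_degree_le d f -> (msize f.['X_j] <= d.+1)%N.
Proof.
move=> fd; rewrite horner_coef; apply: msize_sum_leq => i _.
have [fi0|fi0] := eqVneq f`_i 0; first by rewrite fi0 mul0r msize0.
have Xi : (msize ('X_j ^+ i : K) <= i.+1)%N.
  rewrite -[X in _ ^+ X]subn0 -prodr_const_nat.
  have := @msize_prod_leq _ (index_iota 0 i) (fun=> 'X_j : K) (fun=> 1%N).
  by rewrite sum1_size size_iota subn0; apply=> _; rewrite msizeXU.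
apply: leq_trans (msizeM_leq _ _) _; move: (fd i) Xi fi0.
by rewrite -msize_poly_eq0; move: (msize f`_i) (msize ('X_j ^+ i)) => a b; lia.
Qed.

End PolynomialRing.

(** * Quasiinvariants and alternation *)

Section QuasiInvariantRing.
Variables n m : nat.
Local Notation K := {mpoly rat[n]}.
Local Notation QI := (@quasiinvariant n m).
Implicit Types P Q : K.

Lemma msymXU (s : 'S_n) i : msym s ('X_i : K) = 'X_(s i).
Proof. by rewrite /msym mmapX mmap1U. Qed.

Lemma qi_symmetric P : P \is symmetric -> QI P.
Proof. by move/issymP=> sP i j _; apply: fixed_modE; apply: sP. Qed.

Lemma qiD P Q : QI P -> QI Q -> QI (P + Q).
Proof. by move=> qP qQ i j ij; apply: fixed_modD; [apply: qP|apply: qQ]. Qed.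

Lemma qiM P Q : QI P -> QI Q -> QI (P * Q).
Proof. by move=> qP qQ i j ij; apply: fixed_modM; [apply: qP|apply: qQ]. Qed.

Lemma qiC c : QI c%:MP.
Proof. by apply: qi_symmetric; apply/issymP=> s; rewrite /msym mmapC. Qed.

Lemma qiZ c P : QI P -> QI (c *: P).
Proof. by rewrite -mul_mpolyC; apply: qiM; apply: qiC. Qed.

Lemma qi_sum (I : Type) (s : seq I) (A : pred I) (f : I -> K) :
  (forall i, A i -> QI (f i)) -> QI (\sum_(i <- s | A i) f i).
Proof.
by move=> qf; apply: (big_ind QI); [apply: (qiC 0)|apply: qiD|exact: qf].
Qed.

Lemma qi_prod (I : Type) (s : seq I) (A : pred I) (f : I -> K) :
  (forall i, A i -> QI (f i)) -> QI (\prod_(i <- s | A i) f i).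
Proof.
by move=> qf; apply: (big_ind QI); [apply: (qiC 1)|apply: qiM|exact: qf].
Qed.

(** Conjugation by [s] carries the transposition of [i'] and [j'] to that of [i] and [j], and [s]
    carries the corresponding linear form along. *)
Lemma qi_msym (s : 'S_n) P : QI P -> QI (msym s P).
Proof.
move=> qP i j ij; pose i' := (s^-1)%g i; pose j' := (s^-1)%g j.
have [|q E] := qP i' j'; first by rewrite (inj_eq perm_inj).
exists (msym s q).
have -> : msym (tperm i j) (msym s P) = msym s (msym (tperm i' j') P).
  rewrite -!msymMm; congr (msym _ _).
  by rewrite [RHS]conjgC tpermJ !permKV.
by rewrite -msymB E msymM rmorphXn /= msymB !msymXU !permKV.
Qed.

Definition alternate P : K := \sum_(s : 'S_n) (-1) ^+ odd_perm s *: msym s P.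

Lemma qi_alternate P : QI P -> QI (alternate P).
Proof. by move=> qP; apply: qi_sum => s _; apply/qiZ/qi_msym. Qed.

Lemma msym_alternate (t : 'S_n) P :
  msym t (alternate P) = (-1) ^+ odd_perm t *: alternate P.
Proof.
rewrite /alternate rmorph_sum scaler_sumr /= (reindex_inj (mulIg t^-1%g)) /=.
apply: eq_bigr => s _; rewrite msymZ -msymMm mulgKV scalerA -signr_addb.
by rewrite odd_permM odd_permV addbC.
Qed.

Lemma alternate_msym (t : 'S_n) P :
  alternate (msym t P) = (-1) ^+ odd_perm t *: alternate P.
Proof.
rewrite /alternate scaler_sumr [RHS](reindex_inj (mulgI t)) /=.
apply: eq_bigr => s _; rewrite scalerA msymMm odd_permM -signr_addb.
by rewrite addKb.
Qed.

Lemma alternateZ c P : alternate (c *: P) = c *: alternate P.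
Proof.
rewrite /alternate scaler_sumr; apply: eq_bigr => s _.
by rewrite msymZ !scalerA mulrC.
Qed.

Lemma alternate_sum (I : Type) (s : seq I) (A : pred I) (f : I -> K) :
  alternate (\sum_(i <- s | A i) f i) = \sum_(i <- s | A i) alternate (f i).
Proof.
rewrite /alternate exchange_big /=; apply: eq_bigr => t _.
by rewrite rmorph_sum /= scaler_sumr.
Qed.

Lemma alternateM_symmetric P Q : P \is symmetric ->
  alternate (P * Q) = P * alternate Q.
Proof.
move/issymP=> sP; rewrite /alternate mulr_sumr; apply: eq_bigr => s _.
by rewrite msymM sP scalerAr.
Qed.

Definition pairs : seq ('I_n * 'I_n) :=
  [seq p : 'I_n * 'I_n <- index_enum _ | (p.1 < p.2)%N].

Definition discr_power : K :=
  \prod_(p <- pairs) ('X_p.1 - 'X_p.2) ^+ (2 * m + 1).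

Lemma divides_alternating P : QI P ->
  (forall i j : 'I_n, i != j -> msym (tperm i j) P = - P) ->
  divides discr_power P.
Proof.
move=> qP aP; apply: (@divides_prod_primes _ _ _ (fun p => 'X_p.1 - 'X_p.2)).
- by rewrite filter_uniq // index_enum_uniq.
- move=> [i j]; rewrite mem_filter /= => /andP[ij _].
  by apply: prime_subX; rewrite -val_eqE /= ltn_eqF.
- move=> [i j] [k l]; rewrite !mem_filter /= => /andP[ij _] /andP[kl _].
  by move/(divides_subX_inj kl ij).
- move=> [i j]; rewrite mem_filter /= => /andP[ij _].
  have nij : i != j by rewrite -val_eqE /= ltn_eqF.
  have [q] := qP i j nij; rewrite aP // opprK => E.
  exists (2^-1 *: q); rewrite -scalerAl -E -mulr2n -scaler_nat scalerA.
  by rewrite mulVf ?scale1r // pnatr_eq0.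
Qed.

Lemma msize_discr_power :
  (\sum_(j < n) j * (2 * m + 1) < msize discr_power)%N.
Proof.
have -> : (\sum_(j < n) j * (2 * m + 1) = \sum_(p <- pairs) (2 * m + 1))%N.
  rewrite big_filter.
  rewrite -(pair_big_dep predT (fun i j : 'I_n => (i < j)%N)
              (fun _ _ => (2 * m + 1)%N)) /=.
  rewrite (exchange_big_dep predT) //=; apply: eq_bigr => j _.
  rewrite sum_nat_const; congr (_ * _)%N.
  rewrite -sum1_card (eq_bigl (fun i : 'I_n => (i < j)%N)) //.
  by rewrite -(big_ord_widen n (fun=> 1%N)) ?sum1_card ?card_ord // ltnW.
rewrite /discr_power /pairs.
(* [msize_prod_gt] asks for its bound at every index, so [f] extends the factors by nonconstant
   values at the pairs that are not increasing. *)
have [f f1 fE] : exists2 f : 'I_n * 'I_n -> K, forall p, (1 < msize (f p))%N &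
   forall p : 'I_n * 'I_n, (p.1 < p.2)%N -> 'X_p.1 - 'X_p.2 = f p.
  exists (fun p : 'I_n * 'I_n => if (p.1 < p.2)%N then 'X_p.1 - 'X_p.2 else 'X_p.1).
    move=> p; case: ifP => [ij|_]; last by rewrite msizeXU.
    by apply: msize_subX; rewrite -val_eqE /= ltn_eqF.
  by move=> p ->.
rewrite (eq_big_seq (fun p => f p ^+ (2 * m + 1))); last first.
  by move=> p; rewrite mem_filter => /andP[ij _]; rewrite fE.
apply: msize_prod_gt => p; rewrite -[X in _ ^+ X]subn0 -prodr_const_nat.
rewrite -[X in (X < _)%N]subn0 -[X in (X < _)%N]muln1 -sum_nat_const_nat.
exact: msize_prod_gt.
Qed.

End QuasiInvariantRing.

(** * The matrix of primitives and its determinant *)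

Section PrimitiveMatrix.
Variables n' m : nat.
Local Notation n := n'.+1.
Local Notation K := {mpoly rat[n]}.

Definition integrand (p : nat) : {poly K} :=
  'X^p * \prod_(l < n) ('X - ('X_l : K)%:P) ^+ m.

(* Index 0 is the constant 1 and index p + 1 an antiderivative of
   t^p \prod_l (t - x_l)^m. *)
Definition primitive (i : nat) : {poly K} :=
  if i is p.+1 then antideriv (integrand p) else 1.

Definition prim_at (i : nat) (j : 'I_n) : K := (primitive i).['X_j].

Lemma prim_at0 j : prim_at 0 j = 1.
Proof. by rewrite /prim_at hornerC. Qed.

Lemma map_integrand (s : 'S_n) p : map_poly (msym s) (integrand p) = integrand p.
Proof.
rewrite /integrand rmorphM /= map_polyXn rmorph_prod /=; congr (_ * _).
rewrite [RHS](reindex_inj (@perm_inj _ s)) /=; apply: eq_bigr => l _.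
by rewrite rmorphXn /= rmorphB /= map_polyX map_polyC /= msymXU.
Qed.

Lemma map_primitive (s : 'S_n) i : map_poly (msym s) (primitive i) = primitive i.
Proof.
case: i => [|p] /=; first by rewrite rmorph1.
apply/polyP=> d; rewrite coef_map /= !coef_poly; case: ifP => _.
  by rewrite msymZ -[in RHS](map_integrand s) coef_map.
exact: msym0.
Qed.

Lemma msym_prim_at (s : 'S_n) i j : msym s (prim_at i j) = prim_at i (s j).
Proof. by rewrite /prim_at -[in RHS](map_primitive s) -msymXU horner_map. Qed.

(** A transposition only moves the evaluation point, so the difference is 0 or an integral between
    two variables, whose integrand contains the [m]-th powers vanishing at both ends. *)
Lemma qi_prim_at i j : quasiinvariant m (prim_at i j).
Proof.
case: i => [|p]; first by rewrite prim_at0; apply: (qiC m 1).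
have key a b : a != b -> divides (('X_b - 'X_a) ^+ (2 * m + 1))
    (prim_at p.+1 b - prim_at p.+1 a).
  move=> ab; rewrite /prim_at.
  pose w := \prod_(l < n | (l != b) && (l != a)) ('X - ('X_l : K)%:P) ^+ m.
  apply: (@divides_horner_sub _ (@mpoly_torsion_free n) _ ('X^p * w)) => [h|].
    by exists (antideriv h); apply: deriv_antideriv.
  rewrite /= deriv_antideriv /integrand (bigD1 b) //= (bigD1 a) //= -/w.
  have AC (R : comNzRingType) (x u v t : R) :
    x * (u * (v * t)) = x * t * (v * u) by ring.
  exact: AC.
move=> a b ab; rewrite eq_sym in ab; rewrite msym_prim_at.
case: tpermP => [->|->|_ _]; first exact: key.
  by have [q E] := key b a ab; exists (- q); rewrite mulNr -E opprB.
by exists 0; rewrite subrr mul0r.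
Qed.

Definition prim_det : K := \det (\matrix_(i < n, j < n) prim_at i j).

Lemma size_primitive (i : 'I_n) : (size (primitive i) <= n * m.+1)%N.
Proof.
case: i => -[|p] pn /=; first by rewrite size_poly1; lia.
apply: leq_trans (size_poly _ _) _.
have s1 : (size (integrand p) <= p + n * m + 1)%N.
  pose w : {poly K} := \prod_(l < n) ('X - ('X_l : K)%:P) ^+ m.
  have sw : (size w <= n * m + 1)%N.
    apply: leq_trans (size_poly_prod_leq _ _) _.
    under eq_bigr do rewrite size_exp_XsubC.
    by rewrite sum_nat_const card_ord; lia.
  apply: leq_trans (size_polyMleq _ w) _; rewrite size_polyXn.
  by move: sw; move: (size w) => a; lia.
by move: s1 pn; move: (size (integrand p)) => a; nia.
Qed.

Lemma prim_det_neq0 : prim_det != 0.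
Proof.
apply: (@det_integrals_neq0 _ n' m (fun j => 'X_j) (fun i => primitive i)) => //.
- exact: mpoly_torsion_free.
- move=> i j /(congr1 (meval (fun l => (l == i)%:R))).
  rewrite !mevalXU eqxx /=.
  by case: eqVneq => // _ /eqP; rewrite oner_eq0.
- by move=> p; rewrite /= deriv_antideriv.
- exact: size_primitive.
Qed.

Lemma alternate_prod (w : 'I_n -> nat) :
  alternate (\prod_i prim_at (w i) i) =
  \det (\matrix_(i < n, j < n) prim_at (w i) j).
Proof.
rewrite /alternate /determinant; apply: eq_bigr => s _.
rewrite scaler_sign mulr_sign rmorph_prod /=.
by under eq_bigr do rewrite msym_prim_at; under [in RHS]eq_bigr do rewrite mxE.
Qed.

Lemma prim_detE : prim_det = alternate (\prod_(i < n) prim_at i i).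
Proof. by rewrite alternate_prod. Qed.

Lemma msize_prim_at (i : nat) (j : 'I_n) :
  (msize (prim_at i j) <= (if i == 0 then 0 else i + n * m).+1)%N.
Proof.
case: i => [|p]; first by rewrite prim_at0 msize1.
apply: msize_horner; apply: total_degree_antideriv.
have td := @total_degree_prod n _ (index_enum 'I_n)
  (fun l => ('X - ('X_l : K)%:P) ^+ m) (fun=> (m * 1)%N)
  (fun l => total_degree_exp m (total_degree_XsubX l)).
have := total_degreeM (total_degree_exp p (@total_degreeX n)) td.
by rewrite sum_nat_const card_ord !muln1.
Qed.

(** Row [i > 0] has degree at most [i + n m]; summed over the rows this is [(2m + 1) n (n - 1) / 2],
    the degree of [discr_power]. *)
Lemma msize_prim_det :
  (msize prim_det <= (\sum_(j < n) j * (2 * m + 1)).+1)%N.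
Proof.
have -> : (\sum_(j < n) j * (2 * m + 1) =
           \sum_(j < n) (if j == 0 :> nat then 0 else j + n * m))%N.
  rewrite big_ord_recl [RHS]big_ord_recl /= add0n.
  under [RHS]eq_bigr => i _ do rewrite /bump /= add1n.
  under [LHS]eq_bigr => i _ do rewrite /bump /= add1n.
  have gauss : forall d, (2 * \sum_(i < d) i.+1 = d * d.+1)%N.
    elim=> [|d IHd]; first by rewrite big_ord0.
    by rewrite big_ord_recr /= mulnDr IHd; lia.
  rewrite -big_distrl [RHS]big_split /= sum_nat_const card_ord.
  by rewrite mulnDr muln1 addnC mulnA [(_ * 2)%N]mulnC gauss -mulnA.
rewrite /prim_det /determinant; apply: msize_sum_leq => s _.
rewrite mulr_sign; case: ifP => _; rewrite ?mmeasureN;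
  apply: msize_prod_leq => i; rewrite mxE; exact: msize_prim_at.
Qed.

Lemma prim_det_discr : exists2 c : rat, c != 0 & prim_det = c *: discr_power n m.
Proof.
have [|i j ij|d dE] := @divides_alternating n m prim_det.
- rewrite prim_detE; apply/qi_alternate/qi_prod => i _; exact: qi_prim_at.
- by rewrite prim_detE msym_alternate odd_tperm ij scaleN1r.
have D0 := prim_det_neq0.
have d0 : d != 0 by apply: contraNneq D0 => d0; rewrite dE d0 mul0r.
have P0 : discr_power n m != 0 by apply: contraNneq D0 => P0; rewrite dE P0 mulr0.
(* The upper bound for [prim_det] and the lower bound for [discr_power] leave degree 0 for the
   cofactor. *)
have sd : msize d == 1%N.
  have := msize_prim_det; rewrite dE msizeM //; have := msize_discr_power n m.
  move: d0; rewrite -msize_poly_eq0.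
  by move: (msize d) (msize (discr_power n m)) (\sum_(j < n) _)%N => a b c; lia.
have /msize_poly1P[c c0 dc] := sd; exists c => //.
by rewrite dE dc mul_mpolyC.
Qed.

(** Both [alternate P] and [prim_det] acquire the same sign under each permutation, so their
    quotient is symmetric. *)
Lemma alternate_quotient P : quasiinvariant m P ->
  exists2 h : K, h \is symmetric & alternate P = h * prim_det.
Proof.
move=> qP; have [i j ij|h hE] := @divides_alternating n m _ (qi_alternate qP).
  by rewrite msym_alternate odd_tperm ij scaleN1r.
have [c c0 DE] := prim_det_discr.
have E : alternate P = (c^-1 *: h) * prim_det.
  by rewrite DE hE -scalerAl -scalerAr scalerA mulVf // scale1r.
exists (c^-1 *: h) => //; apply/issymP=> s.
have := congr1 (msym s) E; rewrite msym_alternate E msymM prim_detE.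
rewrite msym_alternate -prim_detE -scalerAr.
move/(congr1 ( *:%R ((-1) ^+ odd_perm s))).
rewrite !scalerA -signr_addb addbb !scale1r => /(mulIf prim_det_neq0).
by move<-.
Qed.

End PrimitiveMatrix.

Lemma det_row_perm (R : comNzRingType) n (s : 'S_n) (A : 'M[R]_n) :
  \det (\matrix_(i, j) A (s i) j) = (-1) ^+ odd_perm s * \det A.
Proof.
rewrite -det_perm -det_mulmx -row_permE; congr (\det _).
by apply/matrixP=> i j; rewrite !mxE.
Qed.

(** * Symmetric polynomials modulo the elementary ones *)

Section SymmetricIdeal.
Variable n : nat.
Local Notation K := {mpoly rat[n]}.

Lemma mpoly_constant_split (t : K) :
  exists c (u : 'I_n -> K), t = c%:MP + \sum_i 'X_i * u i.
Proof.
elim/mpolyind: t => [|a mon t _ _ [c [u tE]]].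
  exists 0, (fun=> 0); rewrite big1 ?addr0 // => i _; exact: mulr0.
have [->|mon0] := eqVneq mon 0%MM.
  by exists (a + c), u; rewrite mpolyX0 alg_mpolyC mpolyCD -addrA -tE.
have [i mi] : exists i, mon i != 0%N.
  apply/existsP; apply: contraNT mon0; rewrite negb_exists => /forallP h.
  by apply/eqP/mnmP=> i; have := h i; rewrite negbK mnm0E => /eqP.
have monE : mon = (U_(i) + (mon - U_(i)))%MM.
  by apply/mnmP=> j; rewrite mnmDE mnmBE mnm1E; case: eqP => [<-|_]; lia.
exists c, (fun j => u j + (if j == i then a *: 'X_[mon - U_(i)] else 0)).
rewrite (eq_bigr (fun j => 'X_j * u j +
    'X_j * (if j == i then a *: 'X_[mon - U_(i)] else 0))); last first.
  by move=> j _; rewrite mulrDr.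
rewrite big_split /= addrA -tE [RHS]addrC; congr (_ + _).
rewrite (bigD1 i) //= eqxx big1 => [|j /negPf->]; last by rewrite mulr0.
by rewrite addr0 {1}monE mpolyXD -scalerAr.
Qed.

Lemma comp_mpoly_symmetric (t : K) (S : n.-tuple K) :
  (forall i, tnth S i \is symmetric) -> t \mPo S \is symmetric.
Proof.
move=> sS; rewrite comp_mpolyEX; apply: rpred_sum => mon _; apply: rpredZ.
by rewrite comp_mpolyX; apply: rpred_prod => i _; apply: rpredX.
Qed.

(** Write [h] as a polynomial in the elementary symmetric ones and split off its constant term. The
    cofactors stay symmetric, hence quasiinvariant, as [sym_ideal] requires. *)
Lemma symmetric_constant_split (h : K) : h \is symmetric ->
  exists c (u : 'I_n -> K), (forall i, u i \is symmetric) /\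
    h = c%:MP + \sum_(i < n) mesym n rat i.+1 * u i.
Proof.
move=> /sym_fundamental[t [<- _]]; have [c [u ->]] := mpoly_constant_split t.
exists c, (fun i => u i \mPo [tuple mesym n rat i.+1 | i < n]); split.
  move=> i; apply: comp_mpoly_symmetric => j.
  by rewrite tnth_mktuple mesym_sym.
rewrite comp_mpolyD comp_mpolyC rmorph_sum /=; congr (_ + _).
apply: eq_bigr => i _; rewrite rmorphM /= comp_mpolyXU.
by rewrite -tnth_nth tnth_mktuple.
Qed.

Lemma mcoeff0_mesym i : (mesym n rat i.+1)@_0%MM = 0.
Proof.
by apply: (dhomog_nemf_coeff (dhomog_mesym _ _ i.+1)); rewrite /= mdeg0.
Qed.

End SymmetricIdeal.

(** * Stabilisers of the hook, and [Qdet] as a column antisymmetrisation *)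

Section Hook.
Variables (m N r : nat).
Hypothesis rN : (r <= N.+1)%N.
Local Notation n := N.+2.
Local Notation k := r.+1.
Local Notation K := {mpoly rat[n]}.
Local Notation T := (hook_tableau n k).
Local Notation D := (prim_det N.+1 m).
Local Notation cols := (col_set N r).
Local Notation prim := (@prim_at N.+1 m).
Implicit Types (mu nu : r.-tuple 'I_N.+1) (q : 'I_n -> 'I_n) (s t : 'S_n).

Definition leg (i : 'I_n) : bool := (0 < i < k)%N.

Lemma col_stabP s :
  reflect (forall i : 'I_n, (k <= i)%N -> s i = i) (s \in col_stab T).
Proof.
rewrite inE; have cE i := col_hook_tableau i (ltn0Sn r).
apply: (iffP forallP) => [h i ki|h i].
  apply: val_inj => /=; have /eqP := h i; rewrite !cE.
  by case: (ltnP i k); case: (ltnP (s i) k); lia.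
rewrite !cE; case: (ltnP i k) => ik; last by rewrite h // ltnNge ik.
by case: ltnP => // ksi; have E := perm_inj (h _ ksi); rewrite E in ksi; lia.
Qed.

(** Each leg entry is alone in its row, while all other entries share row 0. *)
Lemma row_stabP s :
  reflect (forall i : 'I_n, leg i -> s i = i) (s \in row_stab T).
Proof.
rewrite inE; have rE i := @row_hook_tableau n k i.
apply: (iffP forallP) => [h i /andP[i0 ik]|h i].
  apply: val_inj => /=; have /eqP := h i; rewrite !rE ik.
  by case: ifP; lia.
have [/h -> //|li] := boolP (leg i); rewrite !rE.
have lsi : ~~ leg (s i).
  by apply: contraNN li => lsi; rewrite -(perm_inj (h _ lsi)).
by move: li lsi; rewrite /leg; case: (ltnP i k); case: (ltnP (s i) k); lia.
Qed.

(* Off the leg q is 0, for which prim is the constant 1. *)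
Definition leg_supported q := forall i, ~~ leg i -> q i = ord0.

Definition monomial q : K := \prod_(i < n) prim (q i) i.

Lemma msym_monomial s q : msym s (monomial q) = \prod_(i < n) prim (q i) (s i).
Proof.
by rewrite rmorph_prod /=; apply: eq_bigr => i _; rewrite msym_prim_at.
Qed.

Lemma msym_monomial_leg s q : leg_supported q ->
  msym s (monomial q) = \prod_(i < n | leg i) prim (q i) (s i).
Proof.
move=> q0; rewrite msym_monomial [RHS]big_mkcond; apply: eq_bigr => i _.
by case: (boolP (leg i)) => // /q0 ->; rewrite prim_at0.
Qed.

Lemma leg_hook_row mu : leg_supported (hook_row mu).
Proof. by move=> i /negPf li; rewrite /hook_row -/(leg i) li. Qed.

Lemma qi_monomial q : quasiinvariant m (monomial q).
Proof. by apply: qi_prod => i _; apply: qi_prim_at. Qed.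

(** The identity rows from index [k] on confine the Leibniz formula to permutations in the column
    stabiliser. *)
Definition col_matrix q : 'M[K]_n :=
  \matrix_(i, j) (if (i < k)%N then prim (q i) j else (i == j)%:R).

Lemma col_antisym_monomial q : leg_supported q ->
  col_antisym T (monomial q) = \det (col_matrix q).
Proof.
move=> q0; rewrite /col_antisym /determinant big_mkcond; apply: eq_bigr => s _.
rewrite scaler_sign mulr_sign msym_monomial.
case: col_stabP => [hs|hs].
  have -> // : \prod_(i < n) prim (q i) (s i) = \prod_i col_matrix q i (s i).
  apply: eq_bigr => i _; rewrite mxE; case: ltnP => // ki.
  by rewrite hs // eqxx q0 ?prim_at0 // /leg; lia.
have [i /andP[ki si]] : exists i : 'I_n, (k <= i)%N && (s i != i).
  apply/existsP; apply: contra_notT hs; rewrite negb_exists => /forallP h i ki.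
  by have := h i; rewrite ki negbK => /eqP.
rewrite (bigD1 i) //= mxE ltnNge ki /= eq_sym (negPf si) mul0r oppr0.
by case: ifP.
Qed.

(** The label 0 at the corner gives a row of ones, so column differences turn the primitives into
    integrals between consecutive variables. *)
Lemma Qdet_col_antisym mu :
  Qdet n m mu = col_antisym T (monomial (hook_row mu)).
Proof.
rewrite col_antisym_monomial; last exact: leg_hook_row.
have kn : (k <= n)%N by [].
rewrite (det_identity_rows kn) => [|i j ki]; last by rewrite mxE ltnNge ki.
rewrite det_ones_row => [|j]; last by rewrite !mxE /= prim_at0.
(* [Qdet] has the intervals as rows and the exponents as columns, hence the transpose. *)
rewrite /Qdet -det_tr; congr (\det _); apply/matrixP=> i j.
have varE (a : 'I_k) : var n a = 'X_(widen_ord kn a).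
  rewrite /var insubT; first exact: leq_trans (ltn_ord a) kn.
  by move=> h; congr 'X_ _; apply: val_inj.
have hE : hook_row mu (widen_ord kn (lift ord0 i)) = lift ord0 (tnth mu i).
  rewrite /hook_row /= /bump /= add1n ltnS ltn_ord (tnth_nth ord0) //.
rewrite !mxE /= hE /Rint /integral /prim_at /= /bump /= !add1n !ltnS !ltn_ord.
have -> : 'X_(widen_ord kn (lift ord0 j)) = var n j.+1 by rewrite -varE.
by rewrite -varE.
Qed.

(** * The pairing with complementary products *)

Definition ext_perm mu : 'S_n :=
  odflt 1%g [pick p : 'S_n | [forall i in cols, p i == hook_row mu i]].

(** [hook_row mu] is injective on the column, hence extends to a permutation, and the default [1] is
    not taken. *)
Lemma ext_permE mu : mu \in decr_seqs N r -> {in cols, ext_perm mu =1 hook_row mu}.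
Proof.
move=> /(hook_row_inj rN)/perm_extend[p pE]; rewrite /ext_perm.
case: pickP => [p' /forall_inP h i /h/eqP //|/(_ p)/forall_inP[] i /pE ->//].
Qed.

(** For decreasing [mu], the values of [ext_perm mu] from position [k] on are the labels missing
    from [hook_row mu]: they encode the complement [nu] of the overview, in some order. *)
Definition complement mu : K := \prod_(i < n | ~~ (i < k)%N) prim (ext_perm mu i) i.

Lemma qi_complement mu : quasiinvariant m (complement mu).
Proof. by apply: qi_prod => i _; apply: qi_prim_at. Qed.

Definition full_matrix q mu : 'M[K]_n :=
  \matrix_(i, j) prim (if (i < k)%N then q i else ext_perm mu i) j.

Lemma alternate_monomial q mu : leg_supported q ->
  alternate (monomial q * complement mu) = \det (full_matrix q mu).
Proof.
move=> q0; rewrite /full_matrix -alternate_prod; congr (alternate _).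
rewrite /monomial /complement [in X in _ * X]big_mkcond -big_split /=.
apply: eq_bigr => i _; case: ltnP => [|ki]; first by rewrite mulr1.
by rewrite q0 ?prim_at0 ?mul1r // /leg; lia.
Qed.

Lemma full_det_diag mu : mu \in decr_seqs N r ->
  \det (full_matrix (hook_row mu) mu) = (-1) ^+ odd_perm (ext_perm mu) * D.
Proof.
move=> dmu; rewrite /prim_det -det_row_perm; congr (\det _).
apply/matrixP=> i j; rewrite !mxE; case: ifP => // ik.
by rewrite ext_permE // inE.
Qed.

(** A label of [q] missing from [hook_row mu] is used by [ext_perm mu] at a position from [k] on, so
    two rows coincide. *)
Lemma full_det_off q mu nu : mu \in decr_seqs N r -> nu \in decr_seqs N r ->
  q @: cols = hook_row nu @: cols -> mu != nu -> \det (full_matrix q mu) = 0.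
Proof.
move=> dmu dnu qnu munu.
have /subsetPn[x xq xmu] : ~~ (q @: cols \subset hook_row mu @: cols).
  apply: contra munu => sub; apply/eqP; apply: (hook_row_determines rN) => //.
  apply/esym/eqP; rewrite eqEcard -qnu sub qnu.
  rewrite (card_in_imset (hook_row_inj rN dmu)).
  by rewrite (card_in_imset (hook_row_inj rN dnu)) leqnn.
case/imsetP: xq => i ic xE; pose l := ((ext_perm mu)^-1)%g x.
have lc : l \notin cols.
  apply: contra xmu => lc; apply/imsetP; exists l => //.
  by rewrite -ext_permE // permKV.
have il : i != l by apply: contraNneq lc => <-.
apply: (determinant_alternate il) => j; rewrite !mxE.
by rewrite !inE in ic lc; rewrite ic (negPf lc) permKV xE.
Qed.

(* Both sides are alternating in q, which reduces the identity to q being the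
   row sequence of some mu0; only the term mu = mu0 then survives. *)
Lemma column_expansion q : leg_supported q ->
  D * col_antisym T (monomial q) =
  \sum_(mu in decr_seqs N r) (-1) ^+ odd_perm (ext_perm mu) *
     Qdet n m mu * alternate (monomial q * complement mu).
Proof.
move=> q0; under eq_bigr do rewrite alternate_monomial //.
rewrite col_antisym_monomial //.
have [/dinjectiveP qinj|/dinjectivePn[x xc [y /andP[/= yx yc] qxy]]] :=
  boolP (dinjectiveb q (mem cols)); last first.
  rewrite inE in xc; rewrite inE in yc; rewrite eq_sym in yx.
  rewrite (determinant_alternate yx) => [|j]; last by rewrite !mxE xc yc qxy.
  rewrite mulr0 big1 // => mu _; rewrite (determinant_alternate yx) ?mulr0 //.
  by move=> j; rewrite !mxE xc yc qxy.
have [mu0 dmu0 qmu0] := hook_row_sort rN (q0 ord0 isT) qinj.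
(* [f] is chosen with [hook_row mu0 (f i) = q i] on the column, so both determinants attached to [q]
   are row permutations of those attached to [mu0]. *)
pose f i := if i \in cols then ((ext_perm mu0)^-1)%g (q i) else i.
have fc i : i \in cols -> f i \in cols /\ hook_row mu0 (f i) = q i.
  move=> ic; have := imset_f q ic; rewrite qmu0 => /imsetP[l lc qE].
  suff -> : f i = l by split.
  by rewrite /f ic qE -(ext_permE dmu0 lc) permK.
have finj : injective f.
  move=> i j; case: (boolP (i \in cols)) (fc i) => ic fi;
    case: (boolP (j \in cols)) (fc j) => jc fj E.
  - by apply: qinj => //; rewrite -(fi isT).2 -(fj isT).2 E.
  - by have := (fi isT).1; rewrite E /f (negPf jc) (negPf jc).
  - by have := (fj isT).1; rewrite -E /f (negPf ic) (negPf ic).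
  - by move: E; rewrite /f (negPf ic) (negPf jc).
pose rho := perm finj.
have rhoP (i : 'I_n) : (rho i < k)%N = (i < k)%N /\
    ((i < k)%N -> hook_row mu0 (rho i) = q i) /\ (~~ (i < k)%N -> rho i = i).
  rewrite permE; case: (boolP (i < k)%N) => ik.
    have ic : i \in cols by rewrite inE.
    by have [] := fc i ic; rewrite inE => -> ->.
  have -> : f i = i by rewrite /f inE (negPf ik).
  by rewrite (negPf ik).
have cE : \det (col_matrix q) = (-1) ^+ odd_perm rho * Qdet n m mu0.
  rewrite Qdet_col_antisym // col_antisym_monomial; last exact: leg_hook_row.
  rewrite -det_row_perm; congr (\det _); apply/matrixP=> i j; rewrite !mxE.
  have [-> [h1 h2]] := rhoP i; case: ifP => ik; first by rewrite h1.
  by rewrite h2 ?ik.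
have aE : \det (full_matrix q mu0) =
    (-1) ^+ odd_perm rho * ((-1) ^+ odd_perm (ext_perm mu0) * D).
  rewrite -full_det_diag // -det_row_perm; congr (\det _).
  apply/matrixP=> i j; rewrite !mxE.
  have [-> [h1 h2]] := rhoP i; case: ifP => ik; first by rewrite h1.
  by rewrite h2 ?ik.
rewrite (bigD1 mu0) //= [X in _ + X]big1 ?addr0 => [|mu /andP[dmu ne]]; last first.
  by rewrite (full_det_off dmu dmu0 qmu0 ne) mulr0.
rewrite cE aE.
by case: (odd_perm rho); case: (odd_perm (ext_perm mu0));
  rewrite ?expr0 ?expr1 ?mul1r ?mulN1r ?mulrN ?mulNr ?opprK mulrC.
Qed.

(** * Expansion over the symmetric polynomials *)

Definition leg_family : pred {ffun 'I_n -> 'I_n} :=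
  pfamily ord0 leg (fun=> predT).

Lemma leg_familyP (q : {ffun 'I_n -> 'I_n}) :
  q \in leg_family -> leg_supported q.
Proof.
case/pfamilyP=> /subsetP h _ i li; apply/eqP; apply: contraNT li => qi.
by apply: (h i); rewrite inE.
Qed.

(** Adjugate entries as in Cramer's rule. They do not involve the [s] of [leg_expansion], so the
    same coefficients serve for [col_antisym] and for [alternate]. *)
Definition leg_coef (P : K) (q : {ffun 'I_n -> 'I_n}) : K :=
  \sum_(t : 'S_n) msym t P *
    \prod_(i < n | leg i) (\adj (\matrix_(a < n, b < n) prim a b)) (t i) (q i).

(* Row symmetrisation makes P depend, modulo symmetric functions, on the leg
   variables only; inverting the matrix of primitives by its adjugate expands
   such a polynomial in the products of primitives. *)
Lemma leg_expansion P s :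
  (\prod_(i < n | leg i) D) * msym s (row_sym T P) =
  \sum_(q in leg_family) leg_coef P q * msym s (monomial q).
Proof.
rewrite (eq_bigr (fun q : {ffun 'I_n -> 'I_n} => \sum_(t : 'S_n) msym t P *
   \prod_(i < n | leg i) ((\adj (\matrix_(a < n, b < n) prim a b)) (t i) (q i)
      * prim (q i) (s i)))); last first.
  move=> q /leg_familyP q0; rewrite /leg_coef mulr_suml; apply: eq_bigr => t _.
  by rewrite msym_monomial_leg // big_split mulrA.
rewrite exchange_big /=.
rewrite (eq_bigr (fun t => if (t * s^-1)%g \in row_stab T
   then (\prod_(i < n | leg i) D) * msym t P else 0)); last first.
  move=> t _; rewrite -mulr_sumr.
  (* Summed over [q], the product over the leg factors into entries of adjugate times matrix, that
     is [D] times the identity; it survives only if [t] and [s] agree on the leg. *)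
  rewrite -(@big_distr_big_dep _ _ _ _ _ _ _ ord0 leg (fun=> predT)
     (fun i l => (\adj (\matrix_(a < n, b < n) prim a b)) (t i) l * prim l (s i))).
  have inner (i : 'I_n) : \sum_(l < n)
      (\adj (\matrix_(a < n, b < n) prim a b)) (t i) l * prim l (s i)
      = D *+ (t i == s i).
    have := congr1 (fun M : 'M_n => M (t i) (s i))
      (mul_adj_mx (\matrix_(a < n, b < n) prim a b)).
    rewrite [LHS]mxE [RHS]mxE => E; rewrite -[RHS]E.
    by apply: eq_bigr => l _; congr (_ * _); rewrite mxE.
  under eq_bigr do rewrite inner.
  case: row_stabP => h.
    rewrite mulrC; congr (_ * _); apply: eq_bigr => i /h.
    by rewrite permM => si; rewrite -[in s i]si permKV eqxx.
  have [i /andP[li ti]] : exists i, leg i && (t i != s i).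
    apply/existsP; apply: contra_notT h; rewrite negb_exists => /forallP h i li.
    by have := h i; rewrite li negbK permM => /eqP ->; rewrite permK.
  by rewrite (bigD1 i) //= (negPf ti) mulr0n mul0r mulr0.
rewrite -big_mkcond /= (reindex_inj (mulIg s)) /= rmorph_sum mulr_sumr /=.
by apply: eq_big => [t|t _]; [rewrite mulgK|rewrite msymMm].
Qed.

(** After multiplication by [D] and [e] the left side expands over leg functions [q];
    [column_expansion] and regrouping by [mu] turn the sum over [q] into [e * alternate (P1 *
    complement mu) = e * (h mu * D)], and [e] and [D] cancel. *)
Lemma col_antisym_span P : quasiinvariant m P ->
  exists h : r.-tuple 'I_N.+1 -> K, (forall mu, h mu \is symmetric) /\
    col_antisym T (row_sym T P) = \sum_(mu in decr_seqs N r) h mu * Qdet n m mu.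
Proof.
move=> qP; set P1 := row_sym T P; pose e := \prod_(i < n | leg i) D.
have D0 := prim_det_neq0 N.+1 m.
have e0 : e != 0 by apply/prodf_neq0.
have qP1 : quasiinvariant m P1 by apply: qi_sum => s _; apply: qi_msym.
have hE mu : exists h : K, h \is symmetric /\
    alternate (P1 * complement mu) = h * D.
  by have [h] := alternate_quotient (qiM qP1 (qi_complement mu)); exists h.
have [h hP] := fin_all_exists hE.
have eC : e * col_antisym T P1 =
    \sum_(q in leg_family) leg_coef P q * col_antisym T (monomial q).
  rewrite /col_antisym mulr_sumr.
  under [RHS]eq_bigr do rewrite mulr_sumr.
  rewrite exchange_big; apply: eq_bigr => s _.
  rewrite -scalerAr leg_expansion scaler_sumr; apply: eq_bigr => q _.
  by rewrite scalerAr.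
have eA mu : e * alternate (P1 * complement mu) =
    \sum_(q in leg_family) leg_coef P q * alternate (monomial q * complement mu).
  rewrite /alternate mulr_sumr.
  under [RHS]eq_bigr do rewrite mulr_sumr.
  rewrite exchange_big; apply: eq_bigr => s _.
  rewrite msymM -scalerAr mulrA leg_expansion mulr_suml scaler_sumr.
  by apply: eq_bigr => q _; rewrite msymM -scalerAr mulrA.
exists (fun mu => (-1) ^+ odd_perm (ext_perm mu) * h mu); split.
  by move=> mu; rewrite rpredMsign; case: (hP mu).
apply: (mulfI e0); apply: (mulfI D0).
rewrite eC mulr_sumr.
rewrite (eq_bigr (fun q : {ffun 'I_n -> 'I_n} => \sum_(mu in decr_seqs N r)
   ((-1) ^+ odd_perm (ext_perm mu) * Qdet n m mu) *
    (leg_coef P q * alternate (monomial q * complement mu)))); last first.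
  move=> q /leg_familyP q0; rewrite mulrCA column_expansion // mulr_sumr.
  by apply: eq_bigr => mu _; rewrite mulrCA.
rewrite exchange_big /= !mulr_sumr; apply: eq_bigr => mu _.
rewrite -mulr_sumr -eA (hP mu).2.
move: ((-1) ^+ _) (Qdet _ _ _) (h mu) => a b c; clearbody e; clear.
have AC (R : comNzRingType) (x y z u v : R) :
  x * y * (u * (z * v)) = v * (u * (x * z * y)) by ring.
exact: AC.
Qed.

(** * Independence modulo the symmetric ideal *)

Lemma msym_complement s mu : s \in col_stab T ->
  msym s (complement mu) = complement mu.
Proof.
move=> /col_stabP hs; rewrite rmorph_prod /=; apply: eq_bigr => i ki.
by rewrite msym_prim_at hs // leqNgt.
Qed.

(** [complement nu] involves no primitive at a variable of the first column, so the column
    stabiliser fixes it and each term of the column antisymmetriser contributes the same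
    alternation. *)
Lemma alternate_Qdet mu nu : mu \in decr_seqs N r -> nu \in decr_seqs N r ->
  alternate (Qdet n m mu * complement nu) =
  if mu == nu then #|col_stab T|%:R *: ((-1) ^+ odd_perm (ext_perm nu) * D) else 0.
Proof.
move=> dmu dnu; rewrite Qdet_col_antisym /col_antisym mulr_suml alternate_sum.
rewrite (eq_bigr (fun=> \det (full_matrix (hook_row mu) nu))); last first.
  move=> s cs; rewrite -scalerAl alternateZ -{1}(msym_complement nu cs) -msymM.
  rewrite alternate_msym scalerA -signr_addb addbb scale1r.
  by rewrite alternate_monomial //; apply: leg_hook_row.
rewrite sumr_const -scaler_nat; case: eqVneq => [<-|ne].
  by rewrite full_det_diag.
by rewrite (full_det_off dnu dmu) ?scaler0 // eq_sym.
Qed.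

(** Pairing a relation with [complement nu] leaves a nonzero multiple of [c nu *: D] on one side
    and, the cofactors being quasiinvariant, [D] times a combination of elementary symmetric
    polynomials on the other; cancel [D] and compare constant terms. *)
Lemma Qdet_independent (c : r.-tuple 'I_N.+1 -> rat) :
  sym_ideal m (\sum_(mu in decr_seqs N r) c mu *: Qdet n m mu) ->
  forall mu, mu \in decr_seqs N r -> c mu = 0.
Proof.
case=> g [qg E] nu dnu.
have [h hE] : exists h : 'I_n -> K, forall i,
    alternate (g i * complement nu) = h i * D.
  apply: (fin_all_exists (P := fun i h => alternate (g i * complement nu) = h * D)).
  move=> i; have [h _ hE] := alternate_quotient (qiM (qg i) (qi_complement nu)).
  by exists h.
have E2 : c nu *: (#|col_stab T|%:R *: ((-1) ^+ odd_perm (ext_perm nu) * D)) =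
    (\sum_(i < n) mesym n rat i.+1 * h i) * D.
  transitivity (alternate ((\sum_(i < n) mesym n rat i.+1 * g i) * complement nu)).
    rewrite -E mulr_suml alternate_sum.
    have termE mu : alternate (c mu *: Qdet n m mu * complement nu) =
        c mu *: alternate (Qdet n m mu * complement nu).
      by rewrite -scalerAl alternateZ.
    rewrite [RHS](bigD1 nu dnu) /= [X in _ = X + _]termE.
    rewrite (alternate_Qdet dnu dnu) (eqxx nu).
    rewrite [X in _ + X]big1 ?addr0 // => mu /andP[dmu /negPf ne].
    by rewrite termE (alternate_Qdet dmu dnu) ne scaler0.
  rewrite !mulr_suml alternate_sum; apply: eq_bigr => i _.
  by rewrite -mulrA alternateM_symmetric ?mesym_sym // hE mulrA.
have D0 := prim_det_neq0 N.+1 m.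
move: E2; rewrite !scalerAl => /(mulIf D0) /(congr1 (mcoeff 0%MM)).
rewrite raddf_sum /= big1 => [|i _]; last first.
  by rewrite rmorphM /= mcoeff0_mesym mul0r.
have -> : (-1) ^+ odd_perm (ext_perm nu) =
    ((-1) ^+ odd_perm (ext_perm nu))%:MP :> K.
  by case: (odd_perm _); rewrite ?mpolyCN.
rewrite !mcoeffZ mcoeffC eqxx mulr1 => /eqP; rewrite !mulf_eq0 signr_eq0 orbF.
case/orP=> [/eqP //|]; rewrite pnatr_eq0 => /eqP/cards0_eq c0.
suff : 1%g \in col_stab T by rewrite c0 inE.
by apply/col_stabP=> i _; rewrite perm1.
Qed.

(** * The image of [gamma] *)

Lemma gamma_monomial mu c :
  gamma (hook_shape n k) T (c *: monomial (hook_row mu)) =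
  ((num_standard n (hook_shape n k))%:R / n`!%:R * (c * #|row_stab T|%:R))
    *: Qdet n m mu.
Proof.
rewrite /gamma Qdet_col_antisym -[RHS]scalerA; congr (_ *: _).
have -> : row_sym T (c *: monomial (hook_row mu)) =
    (c * #|row_stab T|%:R) *: monomial (hook_row mu).
  rewrite /row_sym (eq_bigr (fun=> c *: monomial (hook_row mu))).
    by rewrite sumr_const -scaler_nat scalerA mulrC.
  (* Row permutations fix the leg, and off the leg every factor of the monomial is 1. *)
  move=> s /row_stabP hs; rewrite msymZ; congr (_ *: _).
  rewrite msym_monomial; apply: eq_bigr => i _.
  have [/hs -> //|li] := boolP (leg i).
  by rewrite (leg_hook_row mu li) !prim_at0.
rewrite /col_antisym scaler_sumr; apply: eq_bigr => s _.
by rewrite msymZ !scalerA mulrC.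
Qed.

Lemma Qdet_in_image mu : exists2 P, quasiinvariant m P
  & Qdet n m mu = gamma (hook_shape n k) T P.
Proof.
pose a : rat := (num_standard n (hook_shape n k))%:R / n`!%:R * #|row_stab T|%:R.
exists (a^-1 *: monomial (hook_row mu)); first exact/qiZ/qi_monomial.
rewrite gamma_monomial mulrCA -/a mulVf ?scale1r //.
(* The number of standard tableaux is nonzero because [T] itself is standard; the row stabiliser
   contains the identity. *)
rewrite /a !mulf_neq0 ?invr_eq0 ?pnatr_eq0 -?lt0n ?fact_gt0 //.
  rewrite card_gt0; apply/set0Pn; exists T; rewrite inE.
  by apply: hook_tableau_standard.
by rewrite card_gt0; apply/set0Pn; exists 1%g; apply/row_stabP=> i _; rewrite perm1.
Qed.

Lemma qi_Qdet mu : quasiinvariant m (Qdet n m mu).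
Proof.
rewrite Qdet_col_antisym; apply: qi_sum => s _.
exact/qiZ/qi_msym/qi_monomial.
Qed.

(** Modulo the ideal the symmetric coefficients of [col_antisym_span] reduce to their constant
    terms, the remainders being sums of elementary symmetric polynomials times quasiinvariants. *)
Lemma gamma_span P : quasiinvariant m P -> exists c : r.-tuple 'I_N.+1 -> rat,
  sym_ideal m (gamma (hook_shape n k) T P -
               \sum_(mu in decr_seqs N r) c mu *: Qdet n m mu).
Proof.
move=> /col_antisym_span[h [sh hE]]; rewrite /gamma hE.
set a : rat := _ / _.
have hs mu : exists cu : rat * ('I_n -> K), (forall i, cu.2 i \is symmetric) /\
    h mu = cu.1%:MP + \sum_(i < n) mesym n rat i.+1 * cu.2 i.
  by have [c [u cuE]] := symmetric_constant_split (sh mu); exists (c, u).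
have [cu cuP] := fin_all_exists hs.
exists (fun mu => a * (cu mu).1).
exists (fun i => \sum_(mu in decr_seqs N r) a *: ((cu mu).2 i * Qdet n m mu)).
split=> [i|].
  apply: qi_sum => mu _; apply/qiZ/qiM/qi_Qdet/qi_symmetric.
  exact: (cuP mu).1.
under [RHS]eq_bigr do rewrite mulr_sumr.
rewrite exchange_big /= scaler_sumr -sumrB; apply: eq_bigr => mu _.
rewrite {1}(cuP mu).2 mulrDl scalerDr mul_mpolyC scalerA addrAC subrr add0r.
rewrite mulr_suml scaler_sumr; apply: eq_bigr => i _.
by rewrite -mulrA scalerAr.
Qed.

End Hook.

Theorem theorem3 (m n k : nat) (hk : (2 <= k)%N) (hkn : (k <= n)%N) :
  basis_modulo
    (@sym_ideal n m)
    (fun P : {mpoly rat[n]} =>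
       exists2 P0, quasiinvariant m P0
                 & P = gamma (hook_shape n k) (hook_tableau n k) P0)
    (decr_seqs (n - 2) (k - 1))
    (fun mu => Qdet n m mu).
Proof.
case: n hkn => [|[|N]] hkn; [lia|lia|].
case: k hk hkn => [//|r] _; rewrite ltnS => rN.
have -> : (N.+2 - 2 = N)%N by rewrite !subSS subn0.
have -> : (r.+1 - 1 = r)%N by rewrite subSS subn0.
split.
- move=> mu _; exists (Qdet N.+2 m mu).
    by have [P qP E] := Qdet_in_image m rN mu; exists P.
  exists (fun=> 0); split; first by move=> _; apply: (qiC m 0).
  by rewrite subrr big1 // => i _; rewrite mulr0.
- exact: Qdet_independent.
- by move=> _ [P qP ->]; apply: gamma_span.
Qed.
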